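(* Let $G$ be a Polish group and $d$ a left-invariant metric on $G$ inducing its topology. The following are equivalent. (1) $G$ is amenable. (2) For every $\epsilon>0$, every finite subset $F\subseteq G$ and every $1$-Lipschitz map $f:(G,d)\to[0,1]$, there exist $g_1,\dots,g_n\in G$ and barycentric coefficients $\lambda_1,\dots,\lambda_n$ (i.e. $\lambda_i\geq0$, $\sum_i\lambda_i=1$) such that for all $h,h'\in F$, $$\Big|\sum_{i=1}^n\lambda_i f(g_ih)-\sum_{i=1}^n\lambda_i f(g_ih')\Big|<\epsilon.$$
   Context: A topological group is amenable if every continuous action of it on a compact space $X$ admits an invariant Borel probability measure on $X$. *)

(* Defs.v *)
From HB Require Import structures.
From mathcomp Require Import all_boot all_order all_algebra.
From mathcomp Require Import all_classical all_reals all_analysis.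

Set Implicit Arguments.
Unset Strict Implicit.
Unset Printing Implicit Defensive.

Import Order.TTheory GRing.Theory Num.Theory.

Local Open Scope classical_set_scope.
Local Open Scope ring_scope.

HB.mixin Record isTopologicalGroup G & Topological G & Group G := {
  mulg_continuous : continuous (fun p : G * G => (p.1 * p.2)%g) ;
  invg_continuous : continuous (fun x : G => (x^-1)%g)
}.

#[short(type="topologicalGroupType")]
HB.structure Definition TopologicalGroup :=
  { G of Topological G & Group G & isTopologicalGroup G }.

(* Distances are functions on T rather than a metricType structure because a
   Polish group carries two unrelated ones: a left-invariant compatible metric
   need not be complete. *)
Record is_metric (R : realType) (T : Type) (d : T -> T -> R) : Prop := IsMetric {
  metric_ge0 : forall x y, 0 <= d x y ;
  metric_eq0 : forall x y, d x y = 0 <-> x = y ;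
  metric_symm : forall x y, d x y = d y x ;
  metric_triangular : forall x y z, d x z <= d x y + d y z
}.

Definition metric_induces_topology (R : realType) (T : topologicalType)
    (d : T -> T -> R) : Prop :=
  forall (x : T) (A : set T),
    nbhs x A <-> exists2 e : R, 0 < e & [set y | d x y < e] `<=` A.

Definition metric_cauchy_seq (R : realType) (T : Type) (d : T -> T -> R)
    (u : nat -> T) : Prop :=
  forall e : R, 0 < e ->
    exists N : nat, forall m n : nat, (N <= m)%N -> (N <= n)%N -> d (u m) (u n) < e.

Definition metric_complete (R : realType) (T : Type) (d : T -> T -> R) : Prop :=
  forall u : nat -> T, metric_cauchy_seq d u ->
    exists x : T, forall e : R, 0 < e ->
      exists N : nat, forall n : nat, (N <= n)%N -> d (u n) x < e.

Definition separable_space (T : topologicalType) : Prop :=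
  exists2 D : set T, countable D & dense D.

Definition polish_space (R : realType) (T : topologicalType) : Prop :=
  separable_space T /\
  exists d : T -> T -> R,
    [/\ is_metric d, metric_induces_topology d & metric_complete d].

Definition left_invariant (R : realType) (G : groupType) (d : G -> G -> R) : Prop :=
  forall g x y : G, d (g * x)%g (g * y)%g = d x y.

Record continuous_action (G : topologicalGroupType) (X : topologicalType)
    (act : G -> X -> X) : Prop := ContinuousAction {
  action1 : forall x, act 1%g x = x ;
  actionM : forall g h x, act (g * h)%g x = act g (act h x) ;
  action_continuous : continuous (fun p : G * X => act p.1 p.2)
}.

Definition borel_type (X : ptopologicalType) := g_sigma_algebraType (@open X).

Definition invariant_measure (R : realType) (G : Type) (X : ptopologicalType)
    (act : G -> X -> X) (mu : probability (borel_type X) R) : Prop :=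
  forall (g : G) (A : set (borel_type X)),
    measurable A -> mu (act g @^-1` A) = mu A.

(* Compact spaces are Hausdorff; being a ptopologicalType makes X nonempty
   (the base point plays no other role). *)
Definition amenable (R : realType) (G : topologicalGroupType) : Prop :=
  forall (X : ptopologicalType) (act : G -> X -> X),
    compact [set: X] -> hausdorff_space X -> continuous_action act ->
    exists mu : probability (borel_type X) R, invariant_measure act mu.

Definition one_lipschitz (R : realType) (T : Type) (d : T -> T -> R)
    (f : T -> R) : Prop :=
  forall x y : T, `|f x - f y| <= d x y.

(* Main.v *)
(** (1) => (2).  The closure [X] of the left translates of [f], for pointwise
    convergence, is a compact space of 1-Lipschitz functions on which [G] acts
    continuously.  Under an invariant probability measure on [X] the values
    [phi h] have the same distribution for all [h].  Cutting [X] into finitely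
    many pieces on which the [phi h], [h] in [F], are almost constant and picking
    in each piece a nearby translate of [f], weighted by the measure of the
    piece, gives the barycentric coefficients.

    (2) => (1).  Ultrafilter limits of the averages in (2) give, for each single
    [f], a mean on bounded functions that is right-invariant at [f].  Convolving
    such means yields one that is right-invariant at finitely many Lipschitz
    functions, and a second ultrafilter limit one that is right-invariant at all
    of them, hence at all bounded functions uniformly continuous for [d].
    Pulling continuous functions on a compact [G]-space [X] back to [G] along
    [g |-> g^-1 x] gives an invariant positive functional on [C(X)].  Its
    Riesz-Markov measure is invariant because it is given by an explicit outer
    measure. *)

Require Import Defs.
From HB Require Import structures.
From mathcomp Require Import all_boot all_order all_algebra.
From mathcomp Require Import all_classical all_reals all_analysis.
From mathcomp Require Import lra.

Set Implicit Arguments.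
Unset Strict Implicit.
Unset Printing Implicit Defensive.

Import Order.TTheory GRing.Theory Num.Theory.
Import numFieldNormedType.Exports.

Local Open Scope classical_set_scope.
Local Open Scope ring_scope.

(** * An invariant Riesz-Markov theorem *)

Record positive_normalized (R : realType) (X : topologicalType)
    (L : (X -> R) -> R) : Prop := PositiveNormalized {
  functionalD : forall f g : X -> R, continuous f -> continuous g ->
    L (fun x => f x + g x) = L f + L g ;
  functional_le : forall f g : X -> R, continuous f -> continuous g ->
    (forall x, f x <= g x) -> L f <= L g ;
  functional_cst : forall c : R, L (fun=> c) = c
}.

Section RieszMeasure.
Context (R : realType) (X : ptopologicalType) (L : (X -> R) -> R).
Implicit Types (f g : X -> R) (U V A : set X) (e c : R).
Hypothesis cptX : compact [set: X].
Hypothesis hausX : hausdorff_space X.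
Hypothesis posL : positive_normalized L.

Let LD f g : continuous f -> continuous g ->
  L (fun x => f x + g x) = L f + L g.
Proof. by case: posL => + _ _; exact. Qed.

Let L_le f g : continuous f -> continuous g ->
  (forall x, f x <= g x) -> L f <= L g.
Proof. by case: posL => _ + _; exact. Qed.

Let L_cst c : L (fun=> c) = c.
Proof. by case: posL => _ _; exact. Qed.

(** Vanishing off [U] stands in for the usual compact support inside [U]; [soft_threshold] makes up
    for the difference. *)
Definition test_function (U : set X) : set (X -> R) :=
  [set f : X -> R | [/\ continuous f, forall x, 0 <= f x <= 1 &
               forall x, ~ U x -> f x = 0]].

Definition open_content (U : set X) : R := sup (L @` test_function U).

Definition riesz_outer (A : set X) : R :=
  inf (open_content @` [set U | open U /\ A `<=` U]).

(** The result vanishes off the closed set [e <= f]. For [e > 0] and [f] a test function for [U],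
    that set is compact and lies inside [U]; the price is a loss of at most [e] in the value of
    [L]. *)
Definition soft_threshold (e : R) (f : X -> R) (x : X) : R :=
  Num.max (f x - e) 0.

Lemma soft_threshold_continuous e f :
  continuous f -> continuous (soft_threshold e f).
Proof.
move=> cf x; apply: (@continuous_max _ _ (fun x => f x - e) (fun=> 0)).
  by apply: cvgB; [exact: cf|exact: cvg_cst].
exact: cvg_cst.
Qed.

Lemma soft_threshold_eq0 e f x : f x <= e -> soft_threshold e f x = 0.
Proof. by move=> fe; rewrite /soft_threshold max_r// subr_le0. Qed.

Lemma soft_threshold_le e f : continuous f -> L f <= L (soft_threshold e f) + e.
Proof.
move=> cf; rewrite -{2}(L_cst e) -LD; [|exact: soft_threshold_continuous|].
  apply: L_le => // [x|x].
    by apply: cvgD; [exact: soft_threshold_continuous|exact: cvg_cst].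
  by rewrite -lerBlDr le_max lexx.
by move=> x; exact: cvg_cst.
Qed.

Lemma soft_threshold_itv e f x :
  0 <= e -> 0 <= f x <= 1 -> 0 <= soft_threshold e f x <= 1.
Proof.
move=> e0 /andP[f0 f1]; rewrite /soft_threshold le_max lexx orbT/=.
by rewrite ge_max ler01 andbT lerBlDr (le_trans f1)// lerDl.
Qed.

Lemma test_function0 U : test_function U (fun=> 0).
Proof. by split=> // [x|x]; [exact: cvg_cst|rewrite lexx ler01]. Qed.

Lemma test_functionS U V : U `<=` V -> test_function U `<=` test_function V.
Proof. by move=> UV f [cf f01 fU]; split=> // x nVx; apply: fU => /UV. Qed.

Lemma test_function_itv U f : test_function U f -> 0 <= L f <= 1.
Proof.
case=> cf f01 _; apply/andP; split.
  rewrite -(L_cst 0); apply: L_le => // [x|x]; first exact: cvg_cst.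
  by have /andP[] := f01 x.
rewrite -(L_cst 1); apply: L_le => // [x|x]; first exact: cvg_cst.
by have /andP[] := f01 x.
Qed.

Lemma has_sup_test U : has_sup (L @` test_function U).
Proof.
split; first by exists (L (fun=> 0)), (fun=> 0); first exact: test_function0.
by exists 1 => _ [f /test_function_itv/andP[_ ?] <-].
Qed.

Lemma open_content_ub U f : test_function U f -> L f <= open_content U.
Proof.
by move=> Uf; apply: ub_le_sup; [have [] := has_sup_test U|exists f].
Qed.

Lemma open_content_lub U c :
  (forall f, test_function U f -> L f <= c) -> open_content U <= c.
Proof.
move=> h; apply: ge_sup; first by have [] := has_sup_test U.
by move=> _ [f Uf <-]; exact: h.
Qed.

Lemma open_content_ge0 U : 0 <= open_content U.
Proof.
by rewrite -(L_cst 0); apply: open_content_ub; exact: test_function0.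
Qed.

Lemma open_contentS U V : U `<=` V -> open_content U <= open_content V.
Proof.
move=> UV; apply: open_content_lub => f Uf; apply: open_content_ub.
exact: test_functionS Uf.
Qed.

Lemma open_contentT : open_content setT = 1.
Proof.
apply/eqP; rewrite eq_le; apply/andP; split.
  by apply: open_content_lub => f /test_function_itv/andP[].
rewrite -(L_cst 1); apply: open_content_ub; split=> [x|x|x []//].
  exact: cvg_cst.
by rewrite lexx ler01.
Qed.

Lemma open_content_set0 : open_content set0 = 0.
Proof.
apply/eqP; rewrite eq_le open_content_ge0 andbT.
apply: open_content_lub => f [cf _ f0].
by rewrite (_ : f = fun=> 0) ?L_cst//; apply/funext => x; exact: f0.
Qed.

Lemma closed_superlevel e (f : X -> R) : continuous f ->
  closed [set x | e <= f x].
Proof.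
move=> cf; rewrite (_ : mkset _ = f @^-1` `[e, +oo[); last first.
  by apply/seteqP; split=> x; rewrite /= in_itv/= andbT.
apply: (@closed_comp _ _ f) => [x _|]; first exact: cf.
exact: interval_closed.
Qed.

Lemma urysohn_function (A B : set X) : closed A -> closed B ->
  A `&` B = set0 ->
  exists h : X -> R, [/\ continuous h, forall x, 0 <= h x <= 1,
    forall x, A x -> h x = 0 & forall x, B x -> h x = 1].
Proof.
move=> cA cB AB.
have [h [ch hA hB h01]] :=
  @urysohn_ext_itv X R (compact_normal hausX cptX) A B 0 1 cA cB AB ltr01.
exists h; split=> // x; last 2 first.
- by move=> Ax; apply: hA; exists x.
- by move=> Bx; apply: hB; exists x.
by have := h01 (h x); rewrite /= in_itv/=; apply; exists x.
Qed.

(* Split [soft_threshold e f] with a Urysohn function equal to 1 on the closed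
   set [e <= f] minus [V] and vanishing outside [U]. *)
Lemma open_contentU U V : open U -> open V ->
  open_content (U `|` V) <= open_content U + open_content V.
Proof.
move=> oU oV; apply: open_content_lub => f [cf f01 fUV].
apply/ler_addgt0Pr => e e0.
have cK : closed ([set x | e <= f x] `&` ~` V).
  by apply: closedI; [exact: closed_superlevel|exact: open_closedC].
have cU : closed (~` U) by exact: open_closedC.
have disj : ~` U `&` ([set x | e <= f x] `&` ~` V) = set0.
  rewrite -subset0 => x [nU [/= ef nV]].
  have : f x = 0 by apply: fUV => -[].
  by move=> fx; rewrite fx leNgt e0 in ef.
have [h [ch h01 h0 h1]] := urysohn_function cU cK disj.
pose g := soft_threshold e f.
have cg : continuous g by exact: soft_threshold_continuous.
have g01 x : 0 <= g x <= 1 by apply: soft_threshold_itv (f01 x); exact: ltW.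
have gE : g = fun x => h x * g x + (1 - h x) * g x.
  by apply/funext => x; rewrite -mulrDl addrC subrK mul1r.
have c1 : continuous (fun x => h x * g x).
  by move=> x; apply: cvgM; [exact: ch|exact: cg].
have c2 : continuous (fun x => (1 - h x) * g x).
  move=> x; apply: cvgM; [|exact: cg].
  by apply: cvgB; [exact: cvg_cst|exact: ch].
apply: (le_trans (soft_threshold_le e cf)); rewrite -/g lerD2r gE LD//.
apply: lerD; apply: open_content_ub; split=> // x.
- have /andP[a b] := h01 x; have /andP[a' b'] := g01 x.
  by rewrite mulr_ge0//= mulr_ile1.
- by move=> nU; rewrite h0 ?mul0r.
- have /andP[a b] := h01 x; have /andP[a' b'] := g01 x.
  by rewrite mulr_ge0//= ?subr_ge0// mulr_ile1 ?subr_ge0// gerBl.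
- move=> nV; have [ef|fe] := leP e (f x).
    by rewrite h1 ?subrr ?mul0r.
  by rewrite [g x]soft_threshold_eq0 ?mulr0// ltW.
Qed.

Lemma open_content_bigsetU (U : nat -> set X) n : (forall i, open (U i)) ->
  open_content (\big[setU/set0]_(i < n) U i) <= \sum_(i < n) open_content (U i).
Proof.
move=> oU; elim: n => [|n ih]; first by rewrite !big_ord0 open_content_set0.
rewrite !big_ord_recr/=; apply: le_trans (lerD ih (lexx _)).
apply: open_contentU => //; rewrite -bigcup_mkord.
by apply: bigcup_open => i _.
Qed.

(** Finitely many [U i] cover the compact set [e <= f], so finite subadditivity bounds the
    truncation of [f]; the last term pays for truncating. *)
Lemma test_function_bigcup (U : nat -> set X) f e : (forall i, open (U i)) ->
  0 < e -> test_function (\bigcup_i U i) f ->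
  exists n, L f <= \sum_(i < n) open_content (U i) + e.
Proof.
move=> oU e0 [cf f01 fU].
pose K := [set x | e <= f x].
have cK : compact K.
  by apply: subclosed_compact cptX _ => //; exact: closed_superlevel.
(* Compactness is used along [\oo]: near each point of [K] all late finite unions contain the
   points, so a single [n] serves all of [K]. *)
move/compact_near_coveringP: cK => /(_ nat \oo
  (fun n x => (\big[setU/set0]_(i < n) U i) x) _) [].
  move=> x Kx; have [i _ Uix] : (\bigcup_i U i) x.
    by apply: contrapT => /fU fx; rewrite /K/= fx leNgt e0 in Kx.
  exists (U i, [set n | (i < n)%N]).
    split => /=; last exact: nbhs_infty_gt.
    by apply: open_nbhs_nbhs; split.
  by move=> [y n] /= [Uiy ltin]; rewrite -bigcup_mkord; exists i.
move=> n _ /(_ n (leqnn n)) Kn; exists n.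
apply: (le_trans (soft_threshold_le e cf)); rewrite lerD2r.
apply: (le_trans _ (open_content_bigsetU n oU)).
apply: open_content_ub; split=> [|x|x nU].
- exact: soft_threshold_continuous.
- by apply: soft_threshold_itv (f01 x); exact: ltW.
- rewrite soft_threshold_eq0// leNgt; apply/negP => /ltW efx.
  by apply: nU; exact: Kn.
Qed.

Lemma has_inf_open_content A :
  has_inf (open_content @` [set U | open U /\ A `<=` U]).
Proof.
split; last by exists 0 => _ [U _ <-]; exact: open_content_ge0.
by exists (open_content setT), setT => //; split=> //; exact: openT.
Qed.

Lemma riesz_outer_lb A U : open U -> A `<=` U -> riesz_outer A <= open_content U.
Proof.
move=> oU AU; apply: ge_inf; first by have [] := has_inf_open_content A.
by exists U.
Qed.

Lemma riesz_outer_glb A c :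
  (forall U, open U -> A `<=` U -> c <= open_content U) -> c <= riesz_outer A.
Proof.
move=> h; apply: lb_le_inf; first by have [] := has_inf_open_content A.
by move=> _ [U [oU AU] <-]; exact: h.
Qed.

Lemma riesz_outer_ge0 A : 0 <= riesz_outer A.
Proof. by apply: riesz_outer_glb => U _ _; exact: open_content_ge0. Qed.

Lemma riesz_outerS A B : A `<=` B -> riesz_outer A <= riesz_outer B.
Proof.
move=> AB; apply: riesz_outer_glb => U oU BU; apply: riesz_outer_lb => //.
exact: subset_trans BU.
Qed.

Lemma riesz_outer_open U : open U -> riesz_outer U = open_content U.
Proof.
move=> oU; apply/eqP; rewrite eq_le riesz_outer_lb//=.
by apply: riesz_outer_glb => V _; exact: open_contentS.
Qed.

Lemma riesz_outer_adherent A e : 0 < e ->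
  exists U, [/\ open U, A `<=` U & open_content U < riesz_outer A + e].
Proof.
move=> e0; have [_ [U [oU AU] <-] h] := inf_adherent e0 (has_inf_open_content A).
by exists U.
Qed.

(** * The outer measure and its Caratheodory sets *)

Definition riesz_outerE (A : set X) : \bar R := (riesz_outer A)%:E.

Lemma riesz_outerE_set0 : riesz_outerE set0 = 0%E.
Proof.
by rewrite /riesz_outerE riesz_outer_open ?open_content_set0//; exact: open0.
Qed.

Lemma riesz_outerE_ge0 A : (0 <= riesz_outerE A)%E.
Proof. by rewrite lee_fin riesz_outer_ge0. Qed.

Lemma riesz_outerE_le : {homo riesz_outerE : A B / A `<=` B >-> (A <= B)%E}.
Proof. by move=> A B AB; rewrite lee_fin riesz_outerS. Qed.

Lemma sum_geometric_half (e : R) n :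
  \sum_(i < n) e / 2 ^+ i.+1 = e - e / 2 ^+ n.
Proof.
elim: n => [|n ih]; first by rewrite big_ord0 expr0 divr1 subrr.
rewrite big_ord_recr/= ih exprS invfM.
by set z := (2 ^+ n)^-1; lra.
Qed.

(** Half of [e] is spread geometrically over the open sets approximating the [F i]; the other half
    pays for truncating a test function of their union. *)
Lemma riesz_outerE_sigma_subadditive : sigma_subadditive riesz_outerE.
Proof.
move=> F; apply/lee_addgt0Pr => e e0.
have e20 : 0 < e / 2 by rewrite divr_gt0.
have ei0 i : 0 < (e / 2) / 2 ^+ i.+1 by rewrite divr_gt0// exprn_gt0.
have /choice[U hU] : forall i, exists U, [/\ open U, F i `<=` U &
    open_content U < riesz_outer (F i) + (e / 2) / 2 ^+ i.+1].
  by move=> i; exact: riesz_outer_adherent.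
have oU i : open (U i) by have [] := hU i.
have key f : test_function (\bigcup_i U i) f ->
    ((L f)%:E <= \sum_(i <oo) riesz_outerE (F i) + e%:E)%E.
  move=> hf; have [n Lf] := test_function_bigcup oU e20 hf.
  have : (\sum_(0 <= i < n) riesz_outerE (F i) <=
          \sum_(i <oo) riesz_outerE (F i))%E.
    by apply: nneseries_lim_ge => i _ _; exact: riesz_outerE_ge0.
  move=> /(@leeD2r _ e%:E); apply: le_trans.
  rewrite big_mkord /riesz_outerE sumEFin -EFinD lee_fin.
  apply: (le_trans Lf).
  have : \sum_(i < n) open_content (U i) <=
      \sum_(i < n) (riesz_outer (F i) + (e / 2) / 2 ^+ i.+1).
    by apply: ler_sum => i _; have [_ _ /ltW] := hU i.
  rewrite big_split/= sum_geometric_half.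
  have : 0 < e / 2 / 2 ^+ n by rewrite divr_gt0// exprn_gt0.
  lra.
have FU : \bigcup_i F i `<=` \bigcup_i U i.
  by apply: subset_bigcup => i _; have [] := hU i.
have oUU : open (\bigcup_i U i) by apply: bigcup_open => i _.
apply: (@le_trans _ _ (open_content (\bigcup_i U i))%:E).
  by rewrite lee_fin riesz_outer_lb.
(* The right-hand side is an extended real: [+oo] is trivial, and [-oo] is refuted by the zero test
   function. *)
move: key; case: (_ + _)%E => [r| |] key; last 2 first.
- by rewrite leey.
- by have := key _ (test_function0 _); rewrite leeNy_eq.
by rewrite lee_fin; apply: open_content_lub => f /key; rewrite lee_fin.
Qed.

HB.instance Definition _ := isOuterMeasure.Build R X riesz_outerE
  riesz_outerE_set0 riesz_outerE_ge0 riesz_outerE_le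
  riesz_outerE_sigma_subadditive.

(* It suffices to split an open set [V]; a test function [f] for [V `&` U] and
   one for [V] minus the closed set [e <= f] add up to a test function for [V],
   after truncating [f] at level [e]. *)
Lemma open_caratheodory U : open U -> riesz_outerE.-caratheodory U.
Proof.
move=> oU; apply: (@le_caratheodory_measurable _ _ riesz_outerE) => A.
rewrite /riesz_outerE -EFinD lee_fin; apply: riesz_outer_glb => V oV AV.
have : riesz_outer (A `&` U) <= open_content (V `&` U).
  by apply: riesz_outer_lb; [exact: openI|exact: setSI].
have : riesz_outer (A `&` ~` U) <= riesz_outer (V `&` ~` U).
  by apply: riesz_outerS; exact: setSI.
suff : open_content (V `&` U) + riesz_outer (V `&` ~` U) <= open_content V.
  by lra.
rewrite -lerBrDr; apply: open_content_lub => f [cf f01 fVU].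
apply/ler_addgt0Pr => e e0.
pose W := V `&` ~` [set x | e <= f x].
have oW : open W.
  by apply: openI => //; apply: closed_openC; exact: closed_superlevel.
have : riesz_outer (V `&` ~` U) <= open_content W.
  apply: riesz_outer_lb => // x [Vx nUx]; split=> //=.
  by rewrite fVU; [rewrite leNgt e0|move=> []].
suff : open_content W <= open_content V - (L f - e) by lra.
apply: open_content_lub => g [cg g01 gW].
have := soft_threshold_le e cf.
suff : L (soft_threshold e f) + L g <= open_content V by lra.
have cfe : continuous (soft_threshold e f) by exact: soft_threshold_continuous.
rewrite -LD//; apply: open_content_ub; split=> [x|x|x nV].
- by apply: cvgD; [exact: cfe|exact: cg].
- have [ef|fe] := leP e (f x).
    rewrite gW ?addr0; last by move=> [_]; exact.
    by apply: soft_threshold_itv (f01 x); exact: ltW.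
  by rewrite soft_threshold_eq0 ?add0r// ltW.
- rewrite gW ?addr0; last by move=> [].
  by rewrite soft_threshold_eq0// fVU ?ltW// => -[].
Qed.

(** * The Borel probability measure of the functional *)

Definition riesz_measure (A : set (borel_type X)) : \bar R := riesz_outerE A.

Lemma borel_caratheodory (A : set (borel_type X)) :
  measurable A -> riesz_outerE.-caratheodory A.
Proof.
move=> mA; rewrite -[_ A]/(measurable (A : set (caratheodory_type riesz_outerE))).
(* Being Borel means lying in every sigma-algebra that contains the open sets; here this is the one
   of Caratheodory sets. *)
apply: (mA); split; last by move=> U; exact: open_caratheodory.
split=> [|B mB|B mB]; [exact: measurable0| |exact: bigcupT_measurable].
by rewrite setTD; exact: measurableC.
Qed.

Lemma riesz_measure0 : riesz_measure set0 = 0%E.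
Proof. exact: riesz_outerE_set0. Qed.

Lemma riesz_measure_ge0 A : (0 <= riesz_measure A)%E.
Proof. exact: riesz_outerE_ge0. Qed.

Lemma riesz_measure_semi_sigma_additive : semi_sigma_additive riesz_measure.
Proof.
move=> F mF tF mUF.
apply: (@caratheodory_measure_sigma_additive R X riesz_outerE F) => //.
- by move=> i; exact: borel_caratheodory.
- exact: borel_caratheodory.
Qed.

HB.instance Definition _ := isMeasure.Build _ _ _ riesz_measure
  riesz_measure0 riesz_measure_ge0 riesz_measure_semi_sigma_additive.

Lemma riesz_measure_setT : riesz_measure setT = 1%E.
Proof.
rewrite /riesz_measure /riesz_outerE riesz_outer_open ?open_contentT//.
exact: openT.
Qed.

HB.instance Definition _ := Measure_isProbability.Build _ _ _ riesz_measure
  riesz_measure_setT.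

(** Composition with [t'] turns test functions of the preimage of [U] into test functions of [U]
    with the same value of [L]. The reverse inequality comes from exchanging [t] and [t']. *)
Lemma riesz_outer_homeo (t t' : X -> X) : continuous t -> continuous t' ->
  cancel t' t -> (forall f, continuous f -> L (f \o t') = L f) ->
  forall A, riesz_outer (t @^-1` A) <= riesz_outer A.
Proof.
move=> ct ct' t'K Lt' A; apply: riesz_outer_glb => U oU AU.
apply: (@le_trans _ _ (open_content (t @^-1` U))).
  apply: riesz_outer_lb; last by move=> x; exact: AU.
  by apply: open_comp => // x _; exact: ct.
apply: open_content_lub => f [cf f01 fU].
rewrite -Lt'//; apply: open_content_ub; split=> [x|x|x nU] /=.
- by apply: continuous_comp; [exact: ct'|exact: cf].
- exact: f01.
- by apply: fU; rewrite /= t'K.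
Qed.

(** One measure serves all symmetries of [L] at once. The equality reaches every subset [A], since
    the measure restricts an outer measure built from [L] and the open sets alone. *)
Theorem riesz_invariant_probability :
  exists mu : probability (borel_type X) R,
  forall t t' : X -> X, continuous t -> continuous t' ->
    cancel t t' -> cancel t' t ->
    (forall f, continuous f -> L (f \o t) = L f) ->
    forall A : set (borel_type X), mu (t @^-1` A) = mu A.
Proof.
exists (riesz_measure : probability _ _) => t t' ct ct' tK t'K Lt A.
have Lt' f : continuous f -> L (f \o t') = L f.
  move=> cf; rewrite -Lt; last first.
    by move=> x; apply: continuous_comp; [exact: ct'|exact: cf].
  by congr L; apply/funext => x /=; rewrite tK.
congr EFin; apply/eqP; rewrite eq_le (riesz_outer_homeo ct ct' t'K Lt')/=.
have := riesz_outer_homeo ct' ct tK Lt (t @^-1` A).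
congr (riesz_outer _ <= _).
by apply/funext => x; rewrite /preimage/= t'K.
Qed.

End RieszMeasure.

(** * Means and their ultrafilter limits *)

Definition bounded_function (R : realType) (T : Type) (f : T -> R) : Prop :=
  exists M : R, forall x, `|f x| <= M.

(** A mean is encoded as a total function; its values at unbounded functions are unconstrained. *)
Record is_mean (R : realType) (T : Type) (m : (T -> R) -> R) : Prop := IsMean {
  meanD : forall f g, bounded_function f -> bounded_function g ->
    m (fun x => f x + g x) = m f + m g ;
  meanZ : forall (c : R) f, bounded_function f -> m (fun x => c * f x) = c * m f ;
  mean_le : forall f g, bounded_function f -> bounded_function g ->
    (forall x, f x <= g x) -> m f <= m g ;
  mean_cst : forall c : R, m (fun=> c) = c
}.

Section Means.
Context (R : realType) (T : Type).
Implicit Types (m : (T -> R) -> R) (f g : T -> R) (c M : R).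

Lemma bounded_function_cst c : bounded_function (fun _ : T => c).
Proof. by exists `|c|. Qed.

Lemma bounded_functionD f g : bounded_function f -> bounded_function g ->
  bounded_function (fun x => f x + g x).
Proof.
move=> [M fM] [N gN]; exists (M + N) => x.
by rewrite (le_trans (ler_normD _ _))// lerD.
Qed.

Lemma bounded_functionZ c f : bounded_function f -> bounded_function (fun x => c * f x).
Proof.
by move=> [M fM]; exists (`|c| * M) => x; rewrite normrM ler_wpM2l.
Qed.

Lemma bounded_function_comp (U : Type) (t : U -> T) f :
  bounded_function f -> bounded_function (fun x => f (t x)).
Proof. by move=> [M fM]; exists M. Qed.

Lemma mean_norm_le m f M : is_mean m -> (forall x, `|f x| <= M) -> `|m f| <= M.
Proof.
move=> mm fM; have bf : bounded_function f by exists M.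
have fM' x : - M <= f x <= M by rewrite -ler_norml.
rewrite ler_norml -{1}(mean_cst mm (- M)) -{2}(mean_cst mm M).
by apply/andP; split; apply: (mean_le mm) => // [|x];
  by [exact: bounded_function_cst|case/andP: (fM' x)].
Qed.

Lemma mean_dist_le m f g c : is_mean m -> bounded_function f ->
  bounded_function g -> (forall x, `|f x - g x| <= c) -> `|m f - m g| <= c.
Proof.
move=> mm bf bg fgc.
have -> : m f - m g = m (fun x => f x + (-1) * g x).
  by rewrite (meanD mm)// ?(meanZ mm)// ?mulN1r//; exact: bounded_functionZ.
by apply: mean_norm_le => // x; rewrite mulN1r.
Qed.

Lemma finite_mean n (t : 'I_n -> T) (lambda : 'I_n -> R) :
  (forall i, 0 <= lambda i) -> \sum_(i < n) lambda i = 1 ->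
  is_mean (fun f => \sum_(i < n) lambda i * f (t i)).
Proof.
move=> l0 l1; split=> [f g _ _|c f _|f g _ _ fg|c].
- by rewrite -big_split/=; apply: eq_bigr => i _; rewrite mulrDr.
- by rewrite mulr_sumr; apply: eq_bigr => i _; rewrite mulrCA.
- by apply: ler_sum => i _; rewrite ler_wpM2l.
- by rewrite -mulr_suml l1 mul1r.
Qed.

Section UltraLimit.
Context (U : set_system ((T -> R) -> R)).
Hypothesis ultraU : UltraFilter U.
Hypothesis meanU : U (@is_mean R T).

(** Means send [f] into the compact interval [[- M, M]], so the image of [U] has a cluster point,
    and a cluster point of an ultrafilter is a limit. *)
Lemma mean_ultralimit_cvg f : bounded_function f -> cvg (m f @[m --> U]).
Proof.
move=> [M fM].
have FM : (m f @[m --> U]) `[- M, M]%classic.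
  apply: (@filterS _ U _ (@is_mean R T)) meanU => m mm /=.
  by rewrite in_itv/= -ler_norml (mean_norm_le mm).
have [p [_ clp]] := @segment_compact R (- M) M _ _ FM.
apply/cvg_ex; exists p => V Vp.
have [//|nV] := @in_ultra_setVsetC _ U ((fun m => m f) @^-1` V) ultraU.
by have [|q []] := clp (~` V) V _ Vp.
Qed.

Definition ultralimit f : R := lim (m f @[m --> U]).

Lemma ultralimit_cvg f :
  bounded_function f -> m f @[m --> U] --> ultralimit f.
Proof. exact: mean_ultralimit_cvg. Qed.

Lemma ultralimit_eq f (k : ((T -> R) -> R) -> R) l :
  (forall m, is_mean m -> m f = k m) -> k @ U --> l -> ultralimit f = l.
Proof.
move=> fk kl; apply: cvg_lim => //; apply: cvg_trans kl.
by apply: near_eq_cvg; apply: filterS meanU => m /fk.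
Qed.

Lemma ultralimit_mean : is_mean ultralimit.
Proof.
split=> [f g bf bg|c f bf|f g bf bg fg|c].
- apply: (@ultralimit_eq _ (fun m => m f + m g)) => [m mm|].
    exact: meanD.
  by apply: cvgD; exact: ultralimit_cvg.
- apply: (@ultralimit_eq _ (fun m => c * m f)) => [m mm|]; first exact: meanZ.
  by apply: cvgMl_tmp; exact: ultralimit_cvg.
- rewrite -subr_ge0.
  apply: (cvgr_to_ge (cvgB (ultralimit_cvg bg) (ultralimit_cvg bf))).
  by apply: filterS meanU => m mm; rewrite /= subr_ge0 (mean_le mm).
- apply: (@ultralimit_eq _ (fun=> c)) => [m mm|]; first exact: mean_cst.
  exact: cvg_cst.
Qed.

Lemma ultralimit_dist_le f g c : bounded_function f -> bounded_function g ->
  (\forall m \near U, `|m f - m g| <= c) -> `|ultralimit f - ultralimit g| <= c.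
Proof.
move=> bf bg.
apply: cvgr_to_le; apply: cvg_norm.
by apply: cvgB; exact: ultralimit_cvg.
Qed.

End UltraLimit.

(** This is weak-* compactness of the set of means: the directed constraints [E i] generate a proper
    filter, and a limit along a finer ultrafilter inherits every closed condition of the form
    [|m f - m g| <= c]. *)
Lemma mean_compactness (I : Type) (D : set I) (E : I -> set ((T -> R) -> R)) :
  D !=set0 ->
  (forall i j, D i -> D j -> exists2 k, D k & E k `<=` E i `&` E j) ->
  (forall i, D i -> exists2 m, is_mean m & E i m) ->
  exists2 m', is_mean m' &
    forall i f g c, D i -> bounded_function f -> bounded_function g ->
    (forall m, is_mean m -> E i m -> `|m f - m g| <= c) -> `|m' f - m' g| <= c.
Proof.
move=> [i0 Di0] dirE meanE.
pose B i := @is_mean R T `&` E i.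
have FB : ProperFilter (filter_from D B).
  apply: filter_from_proper; last first.
    by move=> i Di; have [m mm Em] := meanE i Di; exists m.
  apply: filter_from_filter; first by exists i0.
  move=> i j Di Dj; have [k Dk Ek] := dirE i j Di Dj; exists k => //.
  by move=> m [mm /Ek[Ei Ej]].
have [U [ultraU BU]] := ultraFilterLemma FB.
have meanU : U (@is_mean R T) by apply: BU; exists i0 => // m [].
exists (ultralimit U); first exact: ultralimit_mean.
move=> i f g c Di bf bg Efg; apply: ultralimit_dist_le => //.
by apply: BU; exists i => // m [mm Em]; exact: Efg.
Qed.

End Means.

(** * Invariant means from approximately invariant averages *)

Section InvariantMean.
Context (R : realType) (G : topologicalGroupType) (d : G -> G -> R).
Hypothesis d_metric : is_metric d.
Hypothesis d_left_inv : left_invariant d.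
Implicit Types (m : (G -> R) -> R) (f : G -> R) (h : G).

Definition rtranslate h f : G -> R := fun x => f (x * h)%g.

Definition right_invariant_at m f : Prop :=
  forall h, m (rtranslate h f) = m f.

Definition lipschitz01 : set (G -> R) :=
  [set f | one_lipschitz d f /\ forall x, 0 <= f x <= 1].

Hypothesis approx_invariant : forall (eps : R) (F : set G) (f : G -> R),
  0 < eps -> finite_set F -> one_lipschitz d f -> (forall x, 0 <= f x <= 1) ->
  exists (n : nat) (g : 'I_n -> G) (lambda : 'I_n -> R),
    [/\ forall i : 'I_n, 0 <= lambda i,
        \sum_(i < n) lambda i = 1 &
        forall h h' : G, F h -> F h' ->
          `|\sum_(i < n) lambda i * f (g i * h)%g
            - \sum_(i < n) lambda i * f (g i * h')%g| < eps].

Lemma bounded_rtranslate h f :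
  bounded_function f -> bounded_function (rtranslate h f).
Proof. exact: (bounded_function_comp (fun x => x * h)%g). Qed.

Lemma lipschitz01_bounded f : lipschitz01 f -> bounded_function f.
Proof.
move=> [_ f01]; exists 1 => x; have /andP[f0 f1] := f01 x.
by rewrite ger0_norm.
Qed.

(** The constraints are indexed by a finite set and a tolerance; the averages of [approx_invariant]
    are means satisfying each one, and compactness removes the tolerance. *)
Lemma exists_mean_invariant_at f :
  lipschitz01 f -> exists2 m, is_mean m & right_invariant_at m f.
Proof.
move=> lf; have [lipf f01] := lf; have bf := lipschitz01_bounded lf.
pose D : set (set G * R) := [set p | finite_set p.1 /\ 0 < p.2].
pose E (p : set G * R) := [set m : (G -> R) -> R | forall h h', p.1 h -> p.1 h' ->
  `|m (rtranslate h f) - m (rtranslate h' f)| <= p.2].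
have [||| m mm hm] := @mean_compactness R G _ D E.
- by exists (set0, 1); split.
- move=> [F e] [F' e'] [/= fF e0] [/= fF' e'0].
  exists (F `|` F', Num.min e e').
    by split; [rewrite finite_setU|rewrite /= lt_min e0].
  move=> m Em; split=> h h' /= hF hF'.
    have := Em h h' (or_introl hF) (or_introl hF').
    by rewrite /= le_min => /andP[].
  have := Em h h' (or_intror hF) (or_intror hF').
  by rewrite /= le_min => /andP[].
- move=> [F e] [/= fF e0]; have [n [g [l [l0 l1 hl]]]] :=
    approx_invariant e0 fF lipf f01.
  exists (fun k => \sum_(i < n) l i * k (g i)); first exact: finite_mean.
  by move=> h h' hF hF'; apply/ltW/hl.
exists m => // h; apply/eqP; rewrite -subr_eq0 -normr_le0.
apply/ler_addgt0Pr => e e0; rewrite add0r.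
(* Writing [f] as its translate by 1 lets the pair [{h, 1}] turn almost constancy along translates
   into invariance. *)
rewrite -[X in _ - m X](_ : rtranslate 1%g f = f); last first.
  by apply/funext => x; rewrite /rtranslate mulg1.
apply: (hm ([set h; 1%g], e)); [|exact: bounded_rtranslate..|].
  by split=> //=; exact: finite_set2.
by move=> m' _; apply; [left|right].
Qed.

(** For finite averages this is the average over products [y * x], with [y] drawn from [m] and [x]
    from [m']. *)
Definition convolve m m' : (G -> R) -> R :=
  fun f => m' (fun x => m (rtranslate x f)).

Lemma bounded_mean_rtranslate m f : is_mean m -> bounded_function f ->
  bounded_function (fun x => m (rtranslate x f)).
Proof. by move=> mm [M fM]; exists M => x; apply: mean_norm_le => // y; exact: fM. Qed.

Lemma convolve_mean m m' : is_mean m -> is_mean m' -> is_mean (convolve m m').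
Proof.
move=> mm mm'; split=> [f g bf bg|c f bf|f g bf bg fg|c].
- rewrite /convolve -(meanD mm'); try exact: bounded_mean_rtranslate.
  congr m'; apply/funext => x; rewrite -(meanD mm)//; exact: bounded_rtranslate.
- rewrite /convolve -(meanZ mm'); last exact: bounded_mean_rtranslate.
  congr m'; apply/funext => x; rewrite -(meanZ mm)//; exact: bounded_rtranslate.
- apply: (mean_le mm'); try exact: bounded_mean_rtranslate.
  move=> x; apply: (mean_le mm); try exact: bounded_rtranslate.
  by move=> y; exact: fg.
- rewrite /convolve /rtranslate (_ : (fun=> _) = fun=> c) ?(mean_cst mm')//.
  by apply/funext => x; exact: mean_cst.
Qed.

Lemma rtranslateM x h f :
  rtranslate x (rtranslate h f) = rtranslate (x * h)%g f.
Proof. by apply/funext => y; rewrite /rtranslate mulgA. Qed.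

(** By left invariance of [d] all the maps [x |-> f (z * x)] are 1-Lipschitz, and averaging over [z]
    keeps this. Hence [exists_mean_invariant_at] applies to the averaged function too. *)
Lemma lipschitz01_mean_rtranslate m f : is_mean m -> lipschitz01 f ->
  lipschitz01 (fun x => m (rtranslate x f)).
Proof.
move=> mm lf; have [lipf f01] := lf; have bf := lipschitz01_bounded lf; split.
  move=> x y; apply: mean_dist_le => //; try exact: bounded_rtranslate.
  by move=> z; rewrite (le_trans (lipf _ _))// d_left_inv.
move=> x; have bfx := bounded_rtranslate x bf; apply/andP; split.
  rewrite -(mean_cst mm 0); apply: (mean_le mm) => // [|y].
    exact: bounded_function_cst.
  by have /andP[] := f01 (y * x)%g.
rewrite -(mean_cst mm 1); apply: (mean_le mm) => // [|y].
  exact: bounded_function_cst.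
by have /andP[] := f01 (y * x)%g.
Qed.

(* Convolving a mean invariant at the functions of [S] with one invariant at
   the average of [f] gains [f] and loses nothing: this is how a hypothesis on
   single functions yields finitely many at once. *)
Lemma exists_mean_invariant_finite (S : set (G -> R)) :
  finite_set S -> S `<=` lipschitz01 ->
  exists2 m, is_mean m & forall f, S f -> right_invariant_at m f.
Proof.
case/finite_setP=> n; elim: n S => [S|n ih S /eq_cardSP[f Sf /ih {}ih] lS].
  rewrite II0 card_eq0 => /eqP -> _.
  have [|m mm _] := @exists_mean_invariant_at (fun=> 0).
    by split=> [x y|x]; rewrite ?lexx ?ler01// subrr normr0 (metric_ge0 d_metric).
  by exists m.
have [m mm hm] : exists2 m, is_mean m &
    forall g, (S `\ f) g -> right_invariant_at m g.
  by apply: ih => g [/lS].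
have [m' mm' hm'] := exists_mean_invariant_at
  (lipschitz01_mean_rtranslate mm (lS _ Sf)).
exists (convolve m m'); first exact: convolve_mean.
move=> g Sg h; have [->|gf] := pselect (g = f).
  rewrite -[RHS](hm' h); congr m'; apply/funext => x.
  by rewrite rtranslateM.
rewrite /convolve; congr m'; apply/funext => x.
by rewrite rtranslateM !hm.
Qed.

(** Finite sets of functions are directed by union, and invariance at [f] is a closed condition,
    with bound 0, so it passes to the limit exactly. *)
Lemma exists_mean_invariant_lipschitz01 :
  exists2 m, is_mean m & forall f, lipschitz01 f -> right_invariant_at m f.
Proof.
pose D : set (set (G -> R)) := [set S | finite_set S /\ S `<=` lipschitz01].
pose E (S : set (G -> R)) :=
  [set m : (G -> R) -> R | forall f, S f -> right_invariant_at m f].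
have [||| m mm hm] := @mean_compactness R G _ D E.
- by exists set0; split.
- move=> S S' [fS lS] [fS' lS']; exists (S `|` S').
    by split; [rewrite finite_setU|move=> f [/lS|/lS']].
  by move=> m Em; split=> f Sf; apply: Em; [left|right].
- by move=> S [fS lS]; exact: exists_mean_invariant_finite.
exists m => // f lf h; apply/eqP; rewrite -subr_eq0 -normr_le0.
have bf := lipschitz01_bounded lf.
apply: (hm [set f]) => //; last 1 first.
- by move=> m' _ -> //; rewrite subrr normr0.
- by split=> [|g ->]; [exact: finite_set1|].
- exact: bounded_rtranslate.
Qed.

(** For left-invariant [d], closeness of [x] and [y] says that [x^-1 * y] is close to 1: [f] varies
    little under right multiplication by small elements. *)
Definition right_uniformly_continuous f : Prop :=
  forall e : R, 0 < e -> exists2 delta : R, 0 < delta &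
    forall x y, d x y < delta -> `|f x - f y| <= e.

(** Bounded Lipschitz functions are affine images of functions in [lipschitz01], and they
    approximate bounded uniformly continuous functions uniformly. *)
Lemma exists_mean_invariant_uniform :
  exists2 m, is_mean m & forall f, bounded_function f ->
    right_uniformly_continuous f -> right_invariant_at m f.
Proof.
have [m mm hm] := exists_mean_invariant_lipschitz01; exists m => //.
have lip (K M : R) f : 0 < K -> 0 < M -> (forall x, `|f x| <= M) ->
    (forall x y, f x - f y <= K * d x y) -> right_invariant_at m f.
  move=> K0 M0 fM fK h.
  have bf : bounded_function f by exists M.
  have bfh := bounded_rtranslate h bf.
  (* This scale achieves both bounds: [a * K <= 1] gives the Lipschitz constant and
     [a * (2 * M) <= 1] the range of [a * (f + M)]. *)
  pose a := (K + 2 * M)^-1.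
  have KM0 : 0 < K + 2 * M by lra.
  have a0 : 0 < a by rewrite invr_gt0.
  have aKM : a * (K + 2 * M) = 1 by rewrite mulVf// gt_eqF.
  have /hm/(_ h) : lipschitz01 (fun x => a * (f x + M)).
    split=> [x y|x].
      rewrite -mulrBr normrM (gtr0_norm a0) opprD addrACA subrr addr0.
      apply: (@le_trans _ _ (a * (K * d x y))).
        apply: ler_wpM2l; first exact: ltW.
        rewrite ler_norml fK andbT lerNl opprB.
        by rewrite (metric_symm d_metric) fK.
      rewrite mulrA ler_piMl ?(metric_ge0 d_metric)//.
      by have : 0 < a * M := mulr_gt0 a0 M0; lra.
    have := fM x; rewrite ler_norml => /andP[fM1 fM2].
    apply/andP; split; first by apply: mulr_ge0; [exact: ltW|lra].
    by rewrite -aKM; apply: ler_wpM2l; [exact: ltW|lra].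
  have bM := @bounded_function_cst R G M.
  rewrite /rtranslate (meanZ mm); last exact: bounded_functionD.
  rewrite (meanZ mm); last exact: bounded_functionD.
  move/(mulfI (lt0r_neq0 a0)).
  by rewrite (meanD mm)// (meanD mm)// (mean_cst mm) => /addIr.
move=> f [M0 fM0] uf h; apply/eqP; rewrite -subr_eq0 -normr_le0.
apply/ler_addgt0Pr => e e0; rewrite add0r.
(* The approximation error is paid twice, for [f] and for its translate. *)
have e20 : 0 < e / 2 by rewrite divr_gt0.
have [delta delta0 fd] := uf _ e20.
pose M := `|M0| + 1.
have M_gt0 : 0 < M by rewrite /M; have := normr_ge0 M0; lra.
have fM x : - M <= f x <= M.
  rewrite -ler_norml (le_trans (fM0 x))// /M.
  by rewrite (le_trans (ler_norm _))// lerDl.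
(* With this slope the penalty [K * d x y] exceeds the oscillation [2 * M] of [f] once
   [d x y >= delta]; closer points are handled by uniform continuity. *)
pose K := 2 * M / delta.
have K0 : 0 < K by rewrite divr_gt0// mulr_gt0.
pose S x := [set f y + K * d x y | y in [set: G]].
have Kd x y : 0 <= K * d x y by rewrite mulr_ge0 ?(metric_ge0 d_metric)// ltW.
have infS x : has_inf (S x).
  split; first by exists (f 1%g + K * d x 1%g), 1%g.
  by exists (- M) => _ [y _ <-]; have /andP[] := fM y; have := Kd x y; lra.
(* The inf-convolution of [f] with [K * d]: a [K]-Lipschitz function with [f - e / 2 <= g <= f]. *)
pose g x := inf (S x).
have g_le x y : g x <= f y + K * d x y.
  by apply: ge_inf; [have [] := infS x|exists y].
have le_g x c : (forall y, c <= f y + K * d x y) -> c <= g x.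
  by move=> cx; apply: lb_le_inf; [have [] := infS x|move=> _ [y _ <-]].
have d0 x : d x x = 0 by apply/(metric_eq0 d_metric).
have gf x : g x <= f x by rewrite (le_trans (g_le x x))// d0 mulr0 addr0.
have fg x : f x - e / 2 <= g x.
  apply: le_g => y; have [dxy|dxy] := ltP (d x y) delta.
    by have := fd _ _ dxy; rewrite ler_norml => /andP[_]; have := Kd x y; lra.
  have : 2 * M <= K * d x y.
    rewrite -[leLHS](@divfK _ delta) ?gt_eqF//.
    by rewrite ler_wpM2l// ltW.
  by have /andP[] := fM x; have /andP[] := fM y; lra.
have gK x y : g x - g y <= K * d x y.
  rewrite lerBlDr -lerBlDl; apply: le_g => z; rewrite lerBlDl.
  apply: (le_trans (g_le x z)); rewrite addrCA lerD2l -mulrDr.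
  by rewrite ler_wpM2l ?(metric_triangular d_metric)// ltW.
have gM x : `|g x| <= M + e / 2.
  by rewrite ler_norml; have := fM x => /andP[]; have := gf x; have := fg x; lra.
have Me0 : 0 < M + e / 2 by lra.
have bf : bounded_function f by exists M0.
have bg : bounded_function g by exists (M + e / 2).
have fge x : `|f x - g x| <= e / 2.
  by rewrite ler_norml; have := gf x; have := fg x; lra.
have := mean_dist_le mm bf bg fge.
have := mean_dist_le mm (bounded_rtranslate h bf) (bounded_rtranslate h bg)
  (fun x => fge (x * h)%g).
rewrite (lip _ _ _ K0 Me0 gM gK h) !ler_norml; lra.
Qed.

End InvariantMean.

(** * From invariant means to invariant measures *)

Lemma continuous_bounded_function (R : realType) (X : topologicalType)
    (phi : X -> R) :
  compact [set: X] -> continuous phi -> bounded_function phi.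
Proof.
move=> cptX cphi.
have /compact_bounded[M [_ hM]] : compact (phi @` setT).
  by apply: continuous_compact => //; exact: continuous_subspaceT.
by exists (M + 1) => x; apply: (hM (M + 1)); [rewrite ltrDl|exists x].
Qed.

Section OrbitMean.
Context (R : realType) (G : topologicalGroupType) (d : G -> G -> R).
Hypothesis d_metric : is_metric d.
Hypothesis d_left_inv : left_invariant d.
Hypothesis d_topology : metric_induces_topology d.
Context (X : ptopologicalType) (act : G -> X -> X).
Hypothesis cptX : compact [set: X].
Hypothesis cont_act : continuous_action act.
Implicit Types phi : X -> R.

(** The inverse turns composition of [phi] with [act g] into right translation by [g^-1]. *)
Definition orbit_function phi : G -> R := fun g => phi (act g^-1%g point).

Lemma bounded_orbit_function phi :
  continuous phi -> bounded_function (orbit_function phi).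
Proof.
move=> cphi; apply: bounded_function_comp.
exact: continuous_bounded_function.
Qed.

(** Compactness of [X] makes [phi (act u p)] close to [phi p] uniformly in [p] for [u] near 1. *)
Lemma orbit_function_uniform phi :
  continuous phi -> right_uniformly_continuous d (orbit_function phi).
Proof.
move=> cphi e e0.
have : \forall u \near (1%g : G),
    [set: X] `<=` [set p | `|phi (act u p) - phi p| < e].
  move/compact_near_coveringP : cptX; apply => p _.
  have c1 : phi (act q.2 q.1) @[q --> (p, 1%g : G)] --> phi p.
    rewrite -[X in _ --> phi X](action1 cont_act p).
    apply: cvg_comp; last exact: cphi.
    apply: (@cvg_comp _ _ _ (fun q : X * G => (q.2, q.1))
      (fun q : G * X => act q.1 q.2) _ (nbhs (1%g : G, p))).
      by apply: cvg_pair; [exact: cvg_snd|exact: cvg_fst].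
    by move=> V; exact: (@action_continuous _ _ _ cont_act (1%g, p) V).
  have c2 : phi q.1 @[q --> (p, 1%g : G)] --> phi p.
    by apply: cvg_comp; [exact: cvg_fst|exact: cphi].
  have /cvgrPdist_lt/(_ _ e0) :
      phi (act q.2 q.1) - phi q.1 @[q --> (p, 1%g : G)] --> (0 : R).
    by rewrite -(subrr (phi p)); exact: cvgB.
  by apply: filterS => -[q u] /=; rewrite sub0r normrN.
move=> /d_topology[delta delta0 hdelta]; exists delta => // x y dxy.
(* Taking [u = y^-1 * x] and [p = x^-1 point] gives [u p = y^-1 point]. *)
have /hdelta/(_ (act x^-1%g point) I)/= : d 1%g (y^-1 * x)%g < delta.
  by rewrite -(d_left_inv y) mulg1 mulgA mulgV mul1g (metric_symm d_metric).
rewrite -(actionM cont_act) -mulgA mulgV mulg1 distrC.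
exact: ltW.
Qed.

Lemma action_cancel g : cancel (act g) (act g^-1%g).
Proof.
by move=> x; rewrite -(actionM cont_act) mulVg (action1 cont_act).
Qed.

Lemma action_fixed_continuous g : continuous (act g).
Proof.
move=> x.
apply: (@cvg_comp _ _ _ (fun x : X => (g, x)) (fun q : G * X => act q.1 q.2)
  _ (nbhs (g, x))).
  by apply: cvg_pair; [exact: cvg_cst|exact: cvg_id].
by move=> V; exact: (@action_continuous _ _ _ cont_act (g, x) V).
Qed.

Variable m : (G -> R) -> R.
Hypothesis mean_m : is_mean m.
Hypothesis inv_m : forall f, bounded_function f ->
  right_uniformly_continuous d f -> right_invariant_at m f.

Definition orbit_mean phi : R := m (orbit_function phi).

Lemma orbit_mean_positive : positive_normalized orbit_mean.
Proof.
split=> [f g cf cg|f g cf cg fg|c].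
- by rewrite /orbit_mean -(meanD mean_m)//; exact: bounded_orbit_function.
- by apply: (mean_le mean_m);
    [exact: bounded_orbit_function..|move=> x; exact: fg].
- exact: (mean_cst mean_m).
Qed.

Lemma orbit_mean_invariant g phi :
  continuous phi -> orbit_mean (phi \o act g) = orbit_mean phi.
Proof.
move=> cphi; rewrite /orbit_mean.
rewrite -[RHS](inv_m (bounded_orbit_function cphi) (orbit_function_uniform cphi)
  g^-1%g).
congr m; apply/funext => x.
by rewrite /rtranslate /orbit_function /= -(actionM cont_act) invgM invgK.
Qed.

Lemma invariant_probability_of_mean : hausdorff_space X ->
  exists mu : probability (borel_type X) R, invariant_measure act mu.
Proof.
move=> hausX.
have [mu hmu] := riesz_invariant_probability cptX hausX orbit_mean_positive.
exists mu => g A _; apply: (hmu (act g) (act g^-1%g)).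
- exact: action_fixed_continuous.
- exact: action_fixed_continuous.
- exact: action_cancel.
- by move=> x; rewrite -{1}(invgK g) action_cancel.
- by move=> f; exact: orbit_mean_invariant.
Qed.

End OrbitMean.

(** * From invariant measures to approximately invariant averages *)

(** Serves both the total mass of the profile weights and their one-coordinate marginals. *)
Lemma probability_fibers (R : realType) (disp : measure_display)
    (T : measurableType disp) (P : probability T R) (J : finType) (q : T -> J)
    (p : pred J) : (forall c, measurable (q @^-1` [set c])) ->
  fine (P [set x | p (q x)]) = \sum_(c | p c) fine (P (q @^-1` [set c])).
Proof.
move=> mq; rewrite -big_enum.
rewrite (_ : [set x | p (q x)] = [set x | q x \in enum p]); last first.
  by apply/seteqP; split=> x /=; rewrite mem_enum.
have fiber_cons c (r : seq J) : [set x | q x \in c :: r] =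
    q @^-1` [set c] `|` [set x | q x \in r].
  apply/seteqP; split=> x /=; rewrite inE.
    by move=> /orP[/eqP ->|]; [left|right].
  by move=> [->|->]; rewrite ?eqxx ?orbT.
have fiber_nil : [set x | q x \in [::]] = set0 by apply/seteqP; split.
have mr (r : seq J) : measurable [set x | q x \in r].
  elim: r => [|c r ih]; first by rewrite fiber_nil.
  by rewrite fiber_cons; exact: measurableU.
have := enum_uniq p; elim: (enum p) => [_|c r ih /= /andP[cr ur]].
  by rewrite big_nil fiber_nil measure0.
rewrite big_cons -ih// fiber_cons.
rewrite measureU//; first by rewrite fineD ?fin_num_measure.
rewrite -subset0 => x [/= ->]; exact/negP.
Qed.

Lemma measurable_continuous_itv (R : realType) (X : ptopologicalType)
    (k : X -> R) (a b : R) : continuous k ->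
  measurable ([set x | a <= k x < b] : set (borel_type X)).
Proof.
move=> ck.
have mlt c : measurable ([set x | k x < c] : set (borel_type X)).
  apply: sub_sigma_algebra.
  rewrite (_ : mkset _ = k @^-1` `]-oo, c[); last first.
    by apply/seteqP; split=> x; rewrite /= in_itv.
  by apply: open_comp => [x _|]; [exact: ck|exact: interval_open].
rewrite (_ : mkset _ = [set x | k x < b] `\` [set x | k x < a]).
  exact: measurableD.
apply/seteqP; split=> x /=.
  by move=> /andP[ak kb]; split=> //; rewrite ltNge ak.
by move=> [kb /negP]; rewrite -leNgt kb andbT.
Qed.

(** * Pointwise convergence and subspaces *)

Lemma ptws_cvg (I : Type) (V : topologicalType)
    (F : set_system {ptws I -> V}) (t : {ptws I -> V}) : Filter F ->
  (forall i, f i @[f --> F] --> t i) -> F --> t.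
Proof.
move=> FF Ft; apply/cvg_sup => i A /= [_ [[C oC <-] Ct] CA].
apply: filterS CA _; apply: (Ft i); exact: open_nbhs_nbhs.
Qed.

Lemma ptws_eval_continuous (I : eqType) (V : topologicalType) (i : I) :
  continuous (fun f : {ptws I -> V} => f i).
Proof. exact: (@proj_continuous I (fun=> V)). Qed.

Section Subtype.
Context (Y : topologicalType) (A : set Y).

Lemma set_val_continuous : continuous (set_val : A -> Y).
Proof. exact: initial_continuous. Qed.

Lemma set_type_compact : compact A -> compact [set: set_type A].
Proof.
move=> cptA F PF _.
have [|p [Ap clp]] := cptA ((set_val : A -> Y) @ F) _.
  apply: (@filterS _ F _ setT); last exact: filterT.
  by move=> x _ /=; exact: set_valP.
exists (exist _ p (mem_set Ap)); split=> // P Q FP.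
move=> [_ [[W oW <-] Wp] WQ].
have [||_ [[x Px <-] Wx]] := clp (set_val @` P) W.
- by apply: (@filterS _ F _ P) => // x Px; exists x.
- by apply: open_nbhs_nbhs; split.
by exists x; split=> //; exact: WQ.
Qed.

Lemma set_type_hausdorff : hausdorff_space Y -> hausdorff_space (set_type A).
Proof.
move=> hY p q clpq; apply: val_inj; apply: hY => P Q Pp Qq.
have [x [Px Qx]] := clpq _ _ (set_val_continuous Pp) (set_val_continuous Qq).
by exists (set_val x).
Qed.

Lemma set_type_cvg (F : set_system (set_type A)) (x : A) : Filter F ->
  set_val y @[y --> F] --> set_val x -> F --> x.
Proof.
move=> FF Fx P [_ [[W oW <-] Wx] WP]; apply: filterS WP _.
by apply: Fx; exact: open_nbhs_nbhs.
Qed.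

End Subtype.

(** * The orbit closure as a compact [G]-space *)

Section OrbitClosure.
Context (R : realType) (G : topologicalGroupType) (d : G -> G -> R).
Hypothesis d_left_inv : left_invariant d.
Hypothesis d_topology : metric_induces_topology d.
Variable f : G -> R.
Hypothesis f_lip : one_lipschitz d f.
Hypothesis f01 : forall x, 0 <= f x <= 1.

(* The closure, for pointwise convergence, of the left translates of [f]. *)
Definition orbit_closure : set {ptws G -> R} :=
  [set phi | forall (s : seq G) (e : R), 0 < e ->
     exists g, forall h, h \in s -> `|phi h - f (g * h)%g| < e].

Lemma orbit_closure_self : orbit_closure f.
Proof.
by move=> s e e0; exists 1%g => h _; rewrite mul1g subrr normr0.
Qed.

Lemma orbit_closure_itv phi h : orbit_closure phi -> 0 <= phi h <= 1.
Proof.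
move=> Aphi; apply/andP; split; apply/ler_addgt0Pr => e e0;
  have [g /(_ h (mem_head _ _))] := Aphi [:: h] e e0;
  rewrite ltr_norml; have /andP[] := f01 (g * h)%g; lra.
Qed.

Lemma orbit_closure_lip phi : orbit_closure phi -> one_lipschitz d phi.
Proof.
move=> Aphi x y; apply/ler_addgt0Pr => e e0.
have e20 : 0 < e / 2 by rewrite divr_gt0.
have [g hg] := Aphi [:: x; y] _ e20.
have := hg x; rewrite !inE eqxx => /(_ isT).
have := hg y; rewrite !inE eqxx orbT => /(_ isT).
have := f_lip (g * x)%g (g * y)%g; rewrite d_left_inv.
by rewrite !ltr_norml !ler_norml; lra.
Qed.

Lemma closed_orbit_closure : closed orbit_closure.
Proof.
move=> phi clphi s e e0; have e20 : 0 < e / 2 by rewrite divr_gt0.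
have near_phi : nbhs phi [set psi : {ptws G -> R} |
    forall h, h \in s -> `|phi h - psi h| < e / 2].
  elim: s => [|a s ih]; first by apply: filterE.
  have := @ptws_eval_continuous G R a phi => /cvgrPdist_lt/(_ _ e20).
  apply: filterS2 ih => psi hs ha h; rewrite inE => /orP[/eqP ->//|].
  exact: hs.
have [psi [/(_ s _ e20)[g hg] hphi]] := clphi _ near_phi.
exists g => h hs; have := hg h hs; have := hphi h hs.
by rewrite !ltr_norml; lra.
Qed.

Lemma compact_orbit_closure : compact orbit_closure.
Proof.
have cpt := @tychonoff G (fun=> R) (fun=> `[0, 1]%classic)
  (fun=> @segment_compact R 0 1).
apply: subclosed_compact cpt _; first exact: closed_orbit_closure.
by move=> phi /orbit_closure_itv Aphi h /=; rewrite in_itv/=.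
Qed.

(** The base point [f] provides the [ptopologicalType] structure over which [amenable]
    quantifies. *)
Definition orbit_space : Type := set_type orbit_closure.
HB.instance Definition _ := Topological.on orbit_space.
HB.instance Definition _ := isPointed.Build orbit_space
  (exist _ f (mem_set orbit_closure_self)).

Definition translate (g : G) (phi : {ptws G -> R}) : {ptws G -> R} :=
  fun h => phi (g^-1 * h)%g.

Lemma orbit_closure_translate g phi :
  orbit_closure phi -> orbit_closure (translate g phi).
Proof.
move=> Aphi s e e0.
have [g' hg'] := Aphi [seq (g^-1 * h)%g | h <- s] _ e0.
exists (g' * g^-1)%g => h hs; rewrite -mulgA.
by apply: hg'; exact: map_f.
Qed.

Definition orbit_act (g : G) (x : orbit_space) : orbit_space :=
  exist _ (translate g (set_val x))
    (mem_set (orbit_closure_translate g (set_valP x))).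

(** Joint continuity rests on equicontinuity: all points of the closure are 1-Lipschitz, so moving
    [g] costs at most a distance in [G], uniformly in the point; moving [x] is evaluation at the
    fixed [g^-1 * h]. *)
Lemma orbit_act_continuous : continuous_action orbit_act.
Proof.
split=> [x|g h x|[g x]].
- by apply: val_inj; apply/funext => h /=; rewrite /translate invg1 mul1g.
- by apply: val_inj; apply/funext => k; rewrite /= /translate /= invgM -mulgA.
apply: set_type_cvg; apply: ptws_cvg => h /=.
apply/cvgrPdist_lt => e e0; have e20 : 0 < e / 2 by rewrite divr_gt0.
have near_g : \forall q \near (g, x),
    d (g^-1 * h)%g (q.1^-1 * h)%g < e / 2.
  have near_gh : nbhs (g^-1 * h)%g [set k | d (g^-1 * h)%g k < e / 2].
    by apply/d_topology; exists (e / 2).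
  have cV : q.1^-1%g @[q --> (g, x)] --> g^-1%g.
    by apply: cvg_comp; [exact: cvg_fst|move=> V; exact: (@invg_continuous G g V)].
  have cM : (q.1^-1 * h)%g @[q --> (g, x)] --> (g^-1 * h)%g.
    apply: (@cvg_comp _ _ _ (fun q : G * orbit_space => (q.1^-1%g, h))
      (fun p : G * G => (p.1 * p.2)%g) _ (nbhs (g^-1%g, h))).
      by apply: cvg_pair => //; exact: cvg_cst.
    by move=> V; exact: (@mulg_continuous G (g^-1%g, h) V).
  exact: cM near_gh.
have near_x : \forall q \near (g, x),
    `|set_val x (g^-1 * h)%g - set_val q.2 (g^-1 * h)%g| < e / 2.
  have : set_val q.2 (g^-1 * h)%g @[q --> (g, x)] --> set_val x (g^-1 * h)%g.
    apply: (@cvg_comp _ _ _ (fun q : G * orbit_space => set_val q.2)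
      (fun phi : {ptws G -> R} => phi (g^-1 * h)%g) _ (nbhs (set_val x))).
      by apply: cvg_comp; [exact: cvg_snd|exact: set_val_continuous].
    exact: ptws_eval_continuous.
  by move/cvgrPdist_lt; exact.
apply: filterS2 near_g near_x => -[g' x'] /= dg dx.
rewrite -[set_val (orbit_act g x) h]/(set_val x (g^-1 * h)%g).
rewrite -[set_val (orbit_act g' x') h]/(set_val x' (g'^-1 * h)%g).
have : `|set_val x' (g^-1 * h)%g - set_val x' (g'^-1 * h)%g| <=
    d (g^-1 * h)%g (g'^-1 * h)%g.
  exact: (orbit_closure_lip (set_valP x')).
by move: dx; rewrite !ltr_norml ler_norml; lra.
Qed.

Lemma compact_orbit_space : compact [set: orbit_space].
Proof. exact/set_type_compact/compact_orbit_closure. Qed.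

Lemma hausdorff_orbit_space : hausdorff_space orbit_space.
Proof.
apply: set_type_hausdorff.
by apply: (@hausdorff_product G (fun=> R)) => _; exact: Rhausdorff.
Qed.

Lemma orbit_eval_continuous h : continuous (fun x : orbit_space => set_val x h).
Proof.
move=> x; apply: (@cvg_comp _ _ _ (set_val : orbit_space -> {ptws G -> R})
  (fun phi : {ptws G -> R} => phi h) _ (nbhs (set_val x))).
  exact: set_val_continuous.
exact: ptws_eval_continuous.
Qed.

(** * Discretizing an invariant measure at finitely many points *)

Section Discretization.
Variable mu : probability (borel_type orbit_space) R.
Hypothesis mu_inv : invariant_measure orbit_act mu.
Variables (N : nat) (s : seq G).
Hypothesis N_gt0 : (0 < N)%N.

Let N0 : 0 < N%:R :> R. Proof. by rewrite ltr0n. Qed.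

(** There are [N.+1] buckets because the value 1 falls into the one of index [N]; for [r] in
    [[0, 1]] the default of [inord] is never reached. *)
Definition bucket (r : R) : 'I_N.+1 := inord (Num.truncn (N%:R * r)).

Lemma bucket_eq (r : R) (k : 'I_N.+1) : 0 <= r <= 1 ->
  (bucket r == k) = (k%:R / N%:R <= r < k.+1%:R / N%:R).
Proof.
move=> /andP[r0 r1].
have Nr0 : 0 <= N%:R * r by rewrite mulr_ge0.
have tN : (Num.truncn (N%:R * r) < N.+1)%N.
  rewrite ltnS -(ler_nat R) (@le_trans _ _ (N%:R * r)) ?truncn_le//.
  by rewrite ler_piMr.
rewrite -val_eqE /= inordK// truncn_eq//.
by rewrite ler_pdivrMr// ltr_pdivlMr// mulrC.
Qed.

Definition profile (x : orbit_space) : {ffun 'I_(size s) -> 'I_N.+1} :=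
  [ffun i : 'I_(size s) => bucket (set_val x (nth 1%g s i))].

Lemma orbit_space_itv (x : orbit_space) h : 0 <= set_val x h <= 1.
Proof. exact/orbit_closure_itv/set_valP. Qed.

Definition bucket_fiber h (k : 'I_N.+1) : set (borel_type orbit_space) :=
  [set x : orbit_space | bucket (set_val x h) == k].

Lemma measurable_bucket_fiber h k : measurable (bucket_fiber h k).
Proof.
rewrite (_ : bucket_fiber h k = [set x : orbit_space |
    k%:R / N%:R <= set_val x h < k.+1%:R / N%:R]).
  by apply: measurable_continuous_itv; exact: orbit_eval_continuous.
by apply/funext => x; rewrite /bucket_fiber /= bucket_eq// orbit_space_itv.
Qed.

(** Acting by [h^-1] moves the value at [h] to the value at 1. *)
Lemma bucket_fiber_invariant h k :
  mu (bucket_fiber h k) = mu (bucket_fiber 1%g k).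
Proof.
rewrite -(mu_inv h^-1%g (measurable_bucket_fiber 1%g k)); congr (mu _).
apply/funext => x; rewrite /bucket_fiber /preimage /=.
rewrite -[set_val (orbit_act h^-1%g x) 1%g]/(set_val x ((h^-1)^-1 * 1)%g).
by rewrite invgK mulg1.
Qed.

Lemma measurable_profile c :
  measurable (profile @^-1` [set c] : set (borel_type orbit_space)).
Proof.
rewrite (_ : _ @^-1` _ = \bigcap_(i in [set: 'I_(size s)])
    bucket_fiber (nth 1%g s i) (c i)).
  apply: fin_bigcap_measurable => // i _; exact: measurable_bucket_fiber.
apply/seteqP; split=> x /=.
  by move=> <- i _; rewrite /bucket_fiber /= ffunE.
by move=> xc; apply/ffunP => i; rewrite ffunE; exact/eqP/xc.
Qed.

Definition profile_weight (c : {ffun 'I_(size s) -> 'I_N.+1}) : R :=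
  fine (mu (profile @^-1` [set c])).

Lemma profile_weight_ge0 c : 0 <= profile_weight c.
Proof. by rewrite fine_ge0. Qed.

Lemma sum_profile_weight : \sum_c profile_weight c = 1.
Proof.
rewrite -(probability_fibers mu xpredT measurable_profile).
rewrite (_ : mkset _ = setT) ?probability_setT//.
by apply/seteqP; split.
Qed.

(* Invariance enters here: the distribution of the value at a point does not
   depend on the point. *)
Lemma sum_profile_weight_marginal (i : 'I_(size s)) (w : 'I_N.+1 -> R) :
  \sum_c profile_weight c * w (c i) =
  \sum_k fine (mu (bucket_fiber 1%g k)) * w k.
Proof.
rewrite (partition_big (fun c : {ffun _} => c i) xpredT)//=.
apply: eq_bigr => k _.
rewrite -(bucket_fiber_invariant (nth 1%g s i)).
rewrite (_ : bucket_fiber _ _ =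
    [set x | (fun c : {ffun _} => c i == k) (profile x)]); last first.
  by apply/funext => x; rewrite /bucket_fiber /= ffunE.
rewrite (probability_fibers mu (fun c : {ffun _} => c i == k)
  measurable_profile).
by rewrite mulr_suml; apply: eq_bigr => c /eqP ->.
Qed.

(** One [1 / N] is the bucket width, the other the error of approximating [x] by a translate of [f].
    The existential precedes the premise so that choice applies to all profiles; unattained ones
    receive the dummy [g = 1]. *)
Lemma profile_translate (c : {ffun 'I_(size s) -> 'I_N.+1}) :
  exists g : G, (exists x, profile x = c) ->
  forall i : 'I_(size s), `|f (g * nth 1%g s i)%g - (c i)%:R / N%:R| <= 2 / N%:R.
Proof.
have [[x xc]|] := pselect (exists x, profile x = c); last by exists 1%g.
have Nv0 : 0 < N%:R^-1 :> R by rewrite invr_gt0.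
have [g hg] : exists g, forall h, h \in s ->
    `|set_val x h - f (g * h)%g| < N%:R^-1 := set_valP x s _ Nv0.
exists g => _ i; have := hg _ (mem_nth 1%g (ltn_ord i)).
have : bucket (set_val x (nth 1%g s i)) == c i by rewrite -xc ffunE.
rewrite bucket_eq ?orbit_space_itv// -natr1 mulrDl mul1r.
by rewrite ltr_norml ler_norml; lra.
Qed.

Lemma exists_almost_constant_average :
  exists (n : nat) (g : 'I_n -> G) (lambda : 'I_n -> R),
    [/\ forall i, 0 <= lambda i, \sum_(i < n) lambda i = 1 &
        exists S, forall h, h \in s ->
          `|\sum_(i < n) lambda i * f (g i * h)%g - S| <= 2 / N%:R].
Proof.
have /choice[g hg] := profile_translate.
pose J := {ffun 'I_(size s) -> 'I_N.+1}.
have sumJ (F : J -> R) : \sum_(i < #|J|) F (enum_val i) = \sum_c F c.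
  by rewrite [RHS](reindex_onto (@enum_val J J) (@enum_rank J));
    [apply: eq_bigl => i; rewrite enum_valK eqxx|move=> c _; exact: enum_rankK].
exists #|J|, (fun i => g (enum_val i)), (fun i => profile_weight (enum_val i)).
split=> [i||]; first exact: profile_weight_ge0.
  by rewrite (sumJ profile_weight) sum_profile_weight.
(* The common value is the expectation of the lower bucket endpoint, which is the same at every
   point of [s]. *)
exists (\sum_k fine (mu (bucket_fiber 1%g k)) * (k%:R / N%:R)) => h hs.
have si : (index h s < size s)%N by rewrite index_mem.
rewrite (sumJ (fun c => profile_weight c * f (g c * h)%g)).
rewrite -(sum_profile_weight_marginal (Ordinal si) (fun k => k%:R / N%:R)).
rewrite -sumrB (le_trans (ler_norm_sum _ _ _))//.
have -> : 2 / N%:R = \sum_c profile_weight c * (2 / N%:R).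
  by rewrite -mulr_suml sum_profile_weight mul1r.
apply: ler_sum => c _; rewrite -mulrBr normrM ger0_norm ?profile_weight_ge0//.
have [xc|nxc] := pselect (exists x, profile x = c).
  apply: ler_wpM2l; first exact: profile_weight_ge0.
  by have := hg c xc (Ordinal si); rewrite /= nth_index.
(* An unattained profile has an empty fiber, so its dummy translate carries no weight. *)
rewrite (_ : profile_weight c = 0) ?mul0r//.
rewrite /profile_weight (_ : _ @^-1` _ = set0) ?measure0//.
by rewrite -subset0 => x xc; apply: nxc; exists x.
Qed.

End Discretization.
End OrbitClosure.

Theorem theorem17 (R : realType) (G : topologicalGroupType)
    (polishG : polish_space R G) (d : G -> G -> R)
    (d_metric : is_metric d) (d_left_inv : left_invariant d)
    (d_topology : metric_induces_topology d) :
  amenable R G <->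
  (forall (eps : R) (F : set G) (f : G -> R),
     0 < eps -> finite_set F ->
     one_lipschitz d f -> (forall x : G, 0 <= f x <= 1) ->
     exists (n : nat) (g : 'I_n -> G) (lambda : 'I_n -> R),
       [/\ forall i : 'I_n, 0 <= lambda i,
           \sum_(i < n) lambda i = 1 &
           forall h h' : G, F h -> F h' ->
             `|\sum_(i < n) lambda i * f (g i * h)%g
               - \sum_(i < n) lambda i * f (g i * h')%g| < eps]).
Proof.
split=> [amenG eps F f eps0 finF f_lip f01|approx X act cptX hausX cont_act].
  have [mu mu_inv] := amenG (orbit_space f) (@orbit_act R G f)
    (compact_orbit_space f01) (@hausdorff_orbit_space R G f)
    (orbit_act_continuous d_left_inv d_topology f_lip).
  have /finite_seqP[s Fs] := finF.
  (* Two averages within [2 / N] of [S] differ by at most [4 / N], which [N > 5 / eps] keeps below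
     [eps]. *)
  have N_eps := archi_boundP (ltW (divr_gt0 (ltr0n R 5) eps0)).
  set N := Num.bound _ in N_eps.
  have N_gt0 : (0 < N)%N.
    by rewrite -(ltr_nat R) (lt_trans _ N_eps)// divr_gt0.
  have [n [g [lambda [l0 l1 [S hS]]]]] :=
    exists_almost_constant_average f01 mu_inv s N_gt0.
  exists n, g, lambda; split=> // h h'; rewrite Fs /= => /hS hh /hS hh'.
  have N_small : 5 / N%:R < eps.
    by rewrite ltr_pdivrMr ?ltr0n// -ltr_pdivrMl// mulrC.
  have : 0 < N%:R^-1 :> R by rewrite invr_gt0 ltr0n.
  by move: hh hh'; rewrite !ler_norml ltr_norml; lra.
(* This mean is built from [G] and [d] alone; it does not depend on the space [X]. *)
have [m mean_m inv_m] := exists_mean_invariant_uniform d_metric d_left_inv approx.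
exact: (invariant_probability_of_mean d_metric d_left_inv d_topology cptX
  cont_act mean_m inv_m hausX).
Qed.
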